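(* Let $\mathcal H,\mathcal G$ be separable Hilbert spaces and let $A\colon\mathcal H\to\mathcal G$ be bounded. Assume that there are $C>0$ and $\zeta\ge0$ such that for every $N\in\mathbb N_0$ there is an operator $A_N\colon\mathcal H\to\mathcal G$ of rank at most $N$ with $$\|A-A_N\|\le E_N,\qquad E_N=C\frac{\zeta^N}{N!},$$ where $\zeta^0=1$ (so $E_0=C$). For $\tau>0$ define $$\mathcal N_{\mathrm{ex}}(C,\zeta;\tau):=\min\left\{N\in\mathbb N_0:\ C\frac{\zeta^N}{N!}\le\tau\right\}.$$ Then $n(\tau;A)\le\mathcal N_{\mathrm{ex}}(C,\zeta;\tau)$. More explicitly: (1) If $C\le\tau$, then $\mathcal N_{\mathrm{ex}}(C,\zeta;\tau)=0$. (2) If $C>\tau$ and $\zeta=0$, then $\mathcal N_{\mathrm{ex}}(C,\zeta;\tau)=1$. (3) If $C>\tau$ and $\zeta>0$, put $$\rho:=\log\frac C\tau,\qquad \mathcal N_W(C,\zeta;\tau):=\left\lceil\frac{\rho}{W_0\!\left(\rho/(e\zeta)\right)}\right\rceil,$$ where $W_0$ is the principal real branch of the Lambert function. Then $$\mathcal N_{\mathrm{ex}}(C,\zeta;\tau)\le\mathcal N_W(C,\zeta;\tau),\qquad n(\tau;A)\le\mathcal N_W(C,\zeta;\tau).$$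
   Context: $n(\tau;A):=\operatorname{rank}\mathbf 1_{(\tau,\infty)}(|A|)$ with $|A|=(A^*A)^{1/2}$ (for compact $A$, the number of singular values strictly larger than $\tau$, with multiplicity). $\|\cdot\|$ is the operator norm. *)

(* Defs.v *)
From HB Require Import structures.
From mathcomp Require Export all_boot all_order all_algebra.
From mathcomp Require Export complex.
From mathcomp Require Export all_classical all_reals all_analysis.

Set Implicit Arguments.
Unset Strict Implicit.
Unset Printing Implicit Defensive.

Export Order.TTheory GRing.Theory Num.Theory.
Export numFieldNormedType.Exports.

Local Open Scope classical_set_scope.
Local Open Scope complex_scope.
Local Open Scope ring_scope.

(* Complex Hilbert spaces: Banach spaces over R[i] whose norm is induced by an
   inner product.  The inner product is linear in its first argument and
   conjugate-linear in the second. *)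
HB.mixin Record isHilbert (R : realType) (H : Type)
    of CompleteNormedModule R[i] H := {
  inner : {dot H for (@Num.conj R[i])} ;
  inner_norm : forall x : H, `|x| ^+ 2 = inner x x
}.

#[short(type="hilbertType")]
HB.structure Definition Hilbert (R : realType) :=
  {H of CompleteNormedModule R[i] H & isHilbert R H}.

Definition separable (T : topologicalType) : Prop :=
  exists D : set T, countable D /\ dense D.

Section Operators.
Variable R : realType.
Implicit Types H G : hilbertType R.

(* The operator norm, +oo exactly for unbounded operators. The norm of a vector
   is an element of R[i] with zero imaginary part. *)
Definition op_norm H G (A : H -> G) : \bar R :=
  ereal_sup [set (complex.Re `|A x|)%:E | x in [set x : H | `|x| <= 1]].

Definition bounded_op H G (A : H -> G) : Prop :=
  linear A /\ (op_norm A < +oo)%E.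

Definition lin_indep H (n : nat) (v : 'I_n -> H) : Prop :=
  forall c : 'I_n -> R[i], \sum_(i < n) c i *: v i = 0 -> forall i, c i = 0.

(* The dimension of the range, +oo when the range is infinite-dimensional. *)
Definition op_rank H G (A : H -> G) : \bar R :=
  ereal_sup [set n%:R%:E | n in
    [set n : nat | exists x : 'I_n -> H, lin_indep (A \o x)]].

Definition is_adjoint H G (A : H -> G) (B : G -> H) : Prop :=
  bounded_op B /\ forall x y, inner (A x) y = inner x (B y).

Definition self_adjoint H (T : H -> H) : Prop := is_adjoint T T.

(* In R[i], 0 <= z says that z is real and nonnegative. *)
Definition positive_op H (T : H -> H) : Prop :=
  self_adjoint T /\ forall x, 0 <= inner (T x) x.

Definition is_pos_sqrt H (T S : H -> H) : Prop := positive_op S /\ S \o S = T.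

Definition orth_proj H (P : H -> H) : Prop := self_adjoint P /\ P \o P = P.

(* Below, xget selects an element of a set which has exactly one element in the
   situations where the notion is used; the default 0 is then irrelevant. *)

(* Every bounded A has a unique adjoint (Riesz). *)
Definition adjoint H G (A : H -> G) : G -> H :=
  xget (fun=> 0) [set B | is_adjoint A B].

(* |A| = (A^* A)^(1/2); a positive operator has a unique positive square root. *)
Definition abs_op H G (A : H -> G) : H -> H :=
  xget (fun=> 0) [set S | is_pos_sqrt (adjoint A \o A) S].

(* Projection-valued measures on the Borel sets of R; countable additivity is
   expressed through the scalar measures B |-> <E(B) x, x>. The values of E at
   non-measurable sets are unconstrained. *)
Definition scalar_measure H (E : set R -> H -> H) (x : H)
    (mu : {measure set R -> \bar R}) : Prop :=
  forall B, measurable B -> mu B = (complex.Re (inner (E B x) x))%:E.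

Definition is_pvm H (E : set R -> H -> H) : Prop :=
  [/\ forall B, measurable B -> orth_proj (E B),
      E setT = id,
      forall B1 B2, measurable B1 -> measurable B2 ->
        E (B1 `&` B2) = E B1 \o E B2
    & forall x, exists mu, scalar_measure E x mu].

(* T is the integral of lambda dE(lambda), in the weak sense. *)
Definition is_spectral_measure H (T : H -> H) (E : set R -> H -> H) : Prop :=
  is_pvm E /\
  forall (x : H) (mu : {measure set R -> \bar R}), scalar_measure E x mu ->
    mu.-integrable setT (EFin : R -> \bar R) /\
    inner (T x) x = (\int[mu]_l l)%:C.

(* The operator 1_B(T) of the Borel functional calculus of a bounded
   self-adjoint T; the spectral theorem gives existence and uniqueness. *)
Definition spectral_proj H (T : H -> H) (B : set R) : H -> H :=
  xget (fun=> 0) [set P | exists E, is_spectral_measure T E /\ P = E B].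

Definition sv_count H G (tau : R) (A : H -> G) : \bar R :=
  op_rank (spectral_proj (abs_op A) `]tau, +oo[).

Definition fact_bound (C zeta : R) (N : nat) : R := C * zeta ^+ N / N`!%:R.

(* The minimum of a set of naturals that is nonempty whenever 0 < tau. *)
Definition N_ex (C zeta tau : R) : nat :=
  xget 0%N [set N | fact_bound C zeta N <= tau /\
                    forall M, fact_bound C zeta M <= tau -> (N <= M)%N].

(* The principal branch: the inverse of the bijection w |-> w e^w from
   [-1, +oo[ onto [-1/e, +oo[ *)
Definition lambertW0 (x : R) : R :=
  xget 0 [set w | -1 <= w /\ w * expR w = x].

Definition N_W (C zeta tau : R) : int :=
  let rho := ln (C / tau) in
  Num.ceil (rho / lambertW0 (rho / (expR 1 * zeta))).

End Operators.

(* Main.v *)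
Require Import Defs.
From HB Require Import structures.
From mathcomp Require Import ring lra.

(* Write [P] for the spectral projection of [|A|] on [(tau, +oo)]. A nonzero
   vector [x] of the range of [P] has its scalar spectral measure carried by
   [(tau, +oo)], so [<|A| x, x> > tau |x|^2]; expanding
   [0 <= | |A| x - tau x |^2] turns this into [|A x| = | |A| x | > tau |x|]. If
   the range of [P] contained more than [N] independent vectors, an operator
   [A_N] of rank at most [N] would vanish on a nonzero combination [x] of them,
   giving [|A x| = |(A - A_N) x| <= tau |x|] as soon as [E_N <= tau]. Only the
   defining properties of the adjoint, of the square root and of the spectral
   measure are used, never their existence: the default value 0 of [xget]
   satisfies the estimates needed.

   For the Lambert bound, [n^n / n! <= e^n] reduces [C zeta^n / n! <= tau] to
   [(e zeta / n)^n <= e^(- rho)]. With [w = W_0 (rho / (e zeta))] one has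
   [rho / w = zeta e^(1 + w)], so any [n >= rho / w] satisfies both
   [e zeta / n <= e^(- w)] and [n w >= rho]. *)

Local Open Scope classical_set_scope.
Local Open Scope complex_scope.
Local Open Scope ring_scope.

(** * Factorial estimates and the Lambert function *)

Section Counting.
Context {R : realType}.
Set Implicit Arguments.
Unset Strict Implicit.

Lemma exprn_fact_le_expR (x : R) (n : nat) :
  0 <= x -> x ^+ n / n`!%:R <= expR x.
Proof.
move=> x0; case: n => [|n].
  by rewrite expr0 fact0 divr1; apply: le_trans (expR_ge1Dx x); rewrite lerDl.
by apply: le_trans (expR_ge1Dxn n x0); rewrite lerDr.
Qed.

(** Leaving [w] free separates the two demands on [n]; the Lambert value is the [w] at which both
    lower bounds on [n] coincide. *)
Lemma fact_bound_le (C zeta tau w : R) (n : nat) :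
  0 < tau -> 0 < C -> 0 < zeta -> zeta * expR (1 + w) <= n%:R ->
  ln (C / tau) <= n%:R * w -> fact_bound C zeta n <= tau.
Proof.
move=> tau0 C0 zeta0 zn Cn; rewrite /fact_bound.
have Ct : C <= tau * expR (n%:R * w).
  by rewrite mulrC -ler_pdivrMr// -ler_ln ?posrE ?divr_gt0 ?expR_gt0// expRK.
(* Multiplied by [e^n], the left side becomes [(zeta e^(1 + w))^n <= n^n <= n! e^n]. *)
have zE : zeta ^+ n * expR (n%:R * w) <= n`!%:R.
  have f0 : 0 < n`!%:R :> R by rewrite ltr0n fact_gt0.
  have := exprn_fact_le_expR n (ler0n R n).
  rewrite ler_pdivrMr// => nn.
  have e0 := expR_gt0 (n%:R : R).
  rewrite -(ler_pM2l e0); apply: le_trans nn.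
  rewrite mulrCA -expRD -[X in X + _]mulr1 -mulrDr expRM_natl -exprMn.
  by rewrite lerXn2r// nnegrE// mulr_ge0 ?expR_ge0// ltW.
rewrite ler_pdivrMr ?ltr0n ?fact_gt0//.
apply: le_trans (ler_wpM2r _ Ct) _; first by rewrite exprn_ge0// ltW.
by rewrite -mulrA ler_pM2l// mulrC.
Qed.

Lemma lambertW0P (x : R) : 0 < x ->
  0 < lambertW0 x /\ lambertW0 x * expR (lambertW0 x) = x.
Proof.
move=> x0.
have [w1 wx] : [set w | -1 <= w /\ w * expR w = x] (lambertW0 x).
  apply: xgetPex.
  have fc : {within `[0, x], continuous (fun w : R => w * expR w)}.
    apply: continuous_subspaceT => w; apply: cvgM; first exact: cvg_id.
    exact: continuous_expR.
  (* A root lies in [[0, x]] because [0 <= x <= x e^x]. *)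
  have [|c c01 cx] := IVT (ltW x0) fc (v := x).
    rewrite mul0r; apply/andP; split.
      by rewrite ge_min (ltW x0).
    by rewrite le_max ler_peMr ?orbT// ?(ltW x0)// -expR0 ler_expR ltW.
  exists c; split => //.
  by move: c01; rewrite in_itv /= => /andP[c0 _]; apply: le_trans c0; lra.
split=> //; rewrite -(pmulr_lgt0 _ (expR_gt0 (lambertW0 x))).
by rewrite wx.
Qed.

Lemma fact_bound_N_W (C zeta tau : R) : 0 < tau -> tau < C -> 0 < zeta ->
  exists2 n : nat, N_W C zeta tau = n%:Z & fact_bound C zeta n <= tau.
Proof.
move=> tau0 tauC zeta0; rewrite /N_W.
set rho := ln (C / tau); set w := lambertW0 _.
have C0 := lt_trans tau0 tauC.
have rho0 : 0 < rho by rewrite ln_gt0// ltr_pdivlMr// mul1r.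
have ez0 : 0 < expR 1 * zeta by rewrite mulr_gt0 ?expR_gt0.
have [w0 wE] := lambertW0P (divr_gt0 rho0 ez0).
rewrite -/w in w0 wE.
have rw : rho / w = zeta * expR (1 + w).
  have -> : rho = w * expR w * (expR 1 * zeta) by rewrite wE divfK// gt_eqF.
  by rewrite expRD; field; rewrite gt_eqF.
have cge := ceil_ge (rho / w).
have c0 : 0 <= Num.ceil (rho / w).
  by rewrite ceil_ge0 (lt_trans _ (divr_gt0 rho0 w0))// ltrN10.
case: (Num.ceil _) c0 cge => // n _ cge; exists n => //.
apply: (@fact_bound_le _ _ _ w) => //; first by rewrite -rw.
by rewrite -/rho -ler_pdivrMr.
Qed.

Lemma N_exP (C zeta tau : R) (n : nat) : fact_bound C zeta n <= tau ->
  fact_bound C zeta (N_ex C zeta tau) <= tau /\ (N_ex C zeta tau <= n)%N.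
Proof.
move=> nP.
have [|Nle Nmin] := @xgetPex _ 0%N [set N | fact_bound C zeta N <= tau /\
    forall M, fact_bound C zeta M <= tau -> (N <= M)%N].
  have ex : exists N, fact_bound C zeta N <= tau by exists n.
  by case: (ex_minnP ex) => N; exists N.
by split => //; apply: Nmin.
Qed.
End Counting.

(** * Ranks, spectral projections and the modulus of an operator *)

Section Operators.
Context {R : realType}.
Set Implicit Arguments.
Unset Strict Implicit.
Implicit Types H G : hilbertType R.

Lemma op_norm_le H G (B : H -> G) (e : R) : linear B ->
  (op_norm B <= e%:E)%E -> forall x, `|B x| <= e%:C * `|x|.
Proof.
move=> linB Be x.
pose L : {linear H -> G} := HB.pack B (GRing.isLinear.Build _ _ _ _ B linB).
have [->|x0] := eqVneq x 0.
  by rewrite -[B]/(L : _ -> _) linear0 !normr0 mulr0.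
have nx0 : 0 < `|x| by rewrite normr_gt0.
have By : `|B (`|x|^-1 *: x)| <= e%:C.
  rewrite -[leLHS]RRe_real ?normr_real// lecR -lee_fin; apply: le_trans Be.
  apply: ereal_sup_ubound; exists (`|x|^-1 *: x) => //=.
  by rewrite normrZ normfV normr_id mulVf// gt_eqF.
move: By; rewrite -[B]/(L : _ -> _) linearZ/= normrZ normfV normr_id mulrC.
by rewrite ler_pdivrMr.
Qed.

Lemma op_rank_dependent H G (B : H -> G) (N n : nat) (y : 'I_n -> H) :
  linear B -> (op_rank B <= N%:R%:E)%E -> (N < n)%N ->
  exists2 c : 'I_n -> R[i], B (\sum_i c i *: y i) = 0 & exists i, c i != 0.
Proof.
move=> linB rkB Nn.
pose L : {linear H -> G} := HB.pack B (GRing.isLinear.Build _ _ _ _ B linB).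
have : ~ lin_indep (B \o y).
  move=> ind; have : (n%:R%:E <= op_rank B)%E.
    by apply: ereal_sup_ubound; exists n => //=; exists y.
  by move=> /le_trans /(_ rkB); rewrite lee_fin ler_nat leqNgt Nn.
move=> /existsNP[c /not_implyP[c0 /existsNP[i /eqP ci]]].
exists c; last by exists i.
rewrite -[B]/(L : _ -> _) linear_sum -[RHS]c0.
by apply: eq_bigr => j _; rewrite linearZ.
Qed.

Lemma op_rank_le H G (A B : H -> G) (P : H -> H) (tau : R) (N : nat) :
  linear A -> linear B -> linear P -> P \o P = P ->
  (forall x, P x = x -> x != 0 -> tau%:C * `|x| < `|A x|) ->
  (op_rank B <= N%:R%:E)%E -> (op_norm (A \- B)%R <= tau%:E)%E ->
  (op_rank P <= N%:R%:E)%E.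
Proof.
move=> linA linB linP PP PA rkB AB.
apply: ge_ereal_sup => _ /= [n [x ind] <-]; rewrite lee_fin ler_nat leqNgt.
apply/negP => Nn.
have [c Bc [i ci]] := op_rank_dependent (P \o x) linB rkB Nn.
set z := \sum_i _ in Bc.
(* [z] combines the vectors [P (x i)], which the idempotent [P] fixes. *)
have Pz : P z = z.
  pose L : {linear H -> H} := HB.pack P (GRing.isLinear.Build _ _ _ _ P linP).
  rewrite -[P]/(L : _ -> _) linear_sum; apply: eq_bigr => j _.
  by rewrite linearZ /= -[P (P _)]/((P \o P) _) PP.
have z0 : z != 0 by apply: contraNneq ci => /ind ->.
have linAB : linear (A \- B).
  by move=> a u v /=; rewrite linA linB scalerBr opprD addrACA.
have := op_norm_le linAB AB z; rewrite /= Bc subr0 => /le_gtF.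
by rewrite PA.
Qed.

(** The difference of the two sides is the integral of [l - tau] against the scalar measure of [x],
    a nonzero measure carried by [(tau, +oo)]. *)
Lemma spectral_quadratic_gt H (T : H -> H) (E : set R -> H -> H) (tau : R) x :
  is_spectral_measure T E -> E `]tau, +oo[%classic x = x -> x != 0 ->
  exists2 s, inner (T x) x = s%:C & tau * complex.Re (inner x x) < s.
Proof.
move=> [[Eproj ET EI Emu] TE] Ex x0.
have [mu muE] := Emu x.
have [mui Tx] := TE _ _ muE.
set D : set R := `]tau, +oo[%classic in Ex.
have mD : measurable D by exact: measurable_itv.
have muT : mu setT = (complex.Re (inner x x))%:E by rewrite muE// ET.
have muD : mu (~` D) = 0%E.
  (* [E (~D) x = E (~D) (E D x)], and the product is [E] of the empty intersection; [mu set0 = 0]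
     then gives [mu (~D) = 0]. *)
  have ED : E (~` D) x = E set0 x.
    rewrite -[in LHS]Ex -[LHS]/((E _ \o E _) x) -EI//; last exact: measurableC.
    by rewrite setICl.
  by rewrite muE ?ED -?muE ?measure0//; exact: measurableC.
have nx : 0 < inner x x by rewrite -inner_norm exprn_gt0// normr_gt0.
have ex0 : 0 < complex.Re (inner x x) by move: nx; rewrite ltcE => /andP[].
eexists; first exact: Tx.
have taui : mu.-integrable setT (EFin \o (fun=> tau)).
  apply/integrableP; split; first exact: measurable_cst.
  rewrite integral_cst//= -[X in (_ * X)%E]/(mu setT) muT.
  by rewrite -EFinM ltry.
rewrite -subr_gt0.
have -> : tau * complex.Re (inner x x) = \int[mu]_(_ in setT) tau.
  by rewrite Rintegral_cst// muT.
rewrite -RintegralB// /Rintegral.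
have gi : mu.-integrable setT (fun l : R => (l - tau)%:E).
  by under eq_fun do rewrite EFinB; exact: integrableB.
have mg := measurable_int _ gi.
have gabs : (\int[mu]_l (l - tau)%:E = \int[mu]_l `|(l - tau)%:E|)%E.
  apply: ae_eq_integral => //.
    exact: (measurable_int _ (integrable_abse gi)).
  exists (~` D); split => //; first exact: measurableC.
  move=> l /=; apply: contra_not => Dl _.
  rewrite /D/= in_itv/= andbT in Dl.
  by rewrite ger0_norm// subr_ge0 ltW.
rewrite fine_gt0// gabs integrable_lty ?andbT//; last exact: integrable_abse.
(* A vanishing integral of [|l - tau|] would force [l = tau] off a null set [N]. Then [N] contains
   [D], so [mu] is zero, against [mu setT = |x|^2 > 0]. *)
rewrite lt_def integral_ge0// andbT; apply/eqP.
move=> /(ae_eq_integral_abs mu measurableT mg)[N [mN N0 gN]].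
have : (mu setT <= mu N + mu (~` D))%E.
  apply: le_trans (measureU2 _ mN (measurableC mD)).
  apply: le_measure; rewrite ?inE//.
    by apply: measurableU => //; exact: measurableC.
  move=> l _; have [Dl|] := pselect (D l); last by right.
  left; apply: gN => /= /(_ Logic.I) /eqP; rewrite eqe subr_eq0 => /eqP ltau.
  by move: Dl; rewrite /D/= in_itv/= ltau ltxx.
by rewrite N0 muD adde0 muT lee_fin leNgt ex0.
Qed.

Lemma norm_gt_of_inner H (x y : H) (tau s : R) : 0 < tau ->
  inner y x = s%:C -> tau * complex.Re (inner x x) < s -> tau%:C * `|x| < `|y|.
Proof.
move=> tau0 yx taus.
have re z : inner z z = (complex.Re (inner z z))%:C :> R[i].
  by rewrite RRe_real// -inner_norm realX// normr_real.
rewrite -(@ltr_pXn2r _ 2)// ?nnegrE ?mulr_ge0 ?ler0c ?(ltW tau0)//.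
rewrite exprMn !inner_norm.
have : 0 <= inner (y - tau%:C *: x) (y - tau%:C *: x).
  by rewrite -inner_norm exprn_ge0.
have conjR (r : R) : Num.conj (r%:C : R[i]) = r%:C by exact: conjc_real.
rewrite dnormB dnormZ linearZr_LR/= yx conjR -rmorphM/= conjR.
rewrite ger0_norm ?ler0c ?(ltW tau0)// (re _ x) (re _ y).
rewrite -!rmorphXn/= -!rmorphM/= -!rmorphD/= -rmorphB/= ler0c ltcR.
(* Here [|y|^2 >= 2 tau s - tau^2 |x|^2], and [s > tau |x|^2] makes this exceed [tau^2 |x|^2]. *)
move: (complex.Re _) (complex.Re _) taus => b a; nra.
Qed.

(** For a genuine square root [S] of [A^* A], [|S x|^2 = <S (S x), x> = <A^* A x, x>]. An inequality
    suffices and also covers the default 0 of either [xget]. *)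
Lemma norm_abs_op_le H G (A : H -> G) (x : H) : `|abs_op A x| <= `|A x|.
Proof.
have BA : `|inner ((adjoint A \o A) x) x| <= `|A x| ^+ 2.
  rewrite /adjoint; case: xgetP => [B _ [_ AB]|_].
    have -> : inner ((B \o A) x) x = Num.conj (inner (A x) (A x)).
      by rewrite AB (hermC inner (B _)) expr0 mul1r.
    by rewrite norm_conjC -inner_norm normrX normr_id.
  by rewrite /= linear0l normr0 exprn_ge0.
rewrite /abs_op; case: xgetP => [S _ [[[_ SS] _] SE]|_]; last by rewrite normr0.
rewrite -(@ler_pXn2r _ 2)// ?nnegrE// (le_trans _ BA)// -SE /= SS.
by rewrite -inner_norm normrX normr_id.
Qed.

Lemma spectral_projP H (S : H -> H) (tau : R) : 0 < tau ->
  let P := spectral_proj S `]tau, +oo[ in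
  [/\ linear P, P \o P = P
    & forall x, P x = x -> x != 0 -> tau%:C * `|x| < `|S x|].
Proof.
move=> tau0; rewrite /spectral_proj.
case: xgetP => [_ _ [E [SE ->]]|_] /=; last first.
  (* For the default [P = 0], [P x = x] forces [x = 0], so the last claim is vacuous. *)
  by split=> [a u v||x <-]; rewrite ?scaler0 ?addr0 ?eqxx.
have [[Eproj _ _ _] _] := SE.
have [[[linP _] _] PP] := Eproj _ (measurable_itv `]tau, +oo[).
split=> // x Px x0.
have [s Sx taus] := spectral_quadratic_gt SE Px x0.
exact: norm_gt_of_inner tau0 Sx taus.
Qed.
End Operators.

Local Close Scope complex_scope.

Theorem proposition2p6 (R : realType) (H G : hilbertType R) (A : H -> G)
    (C zeta : R) :
  separable H -> separable G -> bounded_op A ->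
  0 < C -> 0 <= zeta ->
  (forall N : nat, exists A_N : H -> G,
     [/\ bounded_op A_N,
         (op_rank A_N <= N%:R%:E)%E
       & (op_norm (A \- A_N)%R <= (fact_bound C zeta N)%:E)%E]) ->
  forall tau : R, 0 < tau ->
  [/\ (sv_count tau A <= (N_ex C zeta tau)%:R%:E)%E,
      C <= tau -> N_ex C zeta tau = 0%N,
      tau < C -> zeta = 0 -> N_ex C zeta tau = 1%N
    & tau < C -> 0 < zeta ->
        ((N_ex C zeta tau)%:Z <= N_W C zeta tau) /\
        (sv_count tau A <= (N_W C zeta tau)%:~R%:E)%E].
Proof.
move=> _ _ [linA _] C0 zeta0 approx tau tau0.
have count n : fact_bound C zeta n <= tau -> (sv_count tau A <= n%:R%:E)%E.
  move=> ntau; have [B [[linB _] rkB AB]] := approx n.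
  have [linP PP Pgt] := spectral_projP (abs_op A) tau0.
  have ABtau : (op_norm (A \- B)%R <= tau%:E)%E.
    by apply: le_trans AB _; rewrite lee_fin.
  apply: (op_rank_le linA linB linP PP _ rkB ABtau) => x Px x0.
  exact: lt_le_trans (Pgt _ Px x0) (norm_abs_op_le A x).
have b0 : fact_bound C zeta 0 = C.
  by rewrite /fact_bound expr0 fact0 mulr1 divr1.
have zeta0_b1 : zeta = 0 -> fact_bound C zeta 1 <= tau.
  by move=> ->; rewrite /fact_bound expr1 mulr0 mul0r ltW.
have N_ex_gt0 : tau < C -> forall n, fact_bound C zeta n <= tau ->
    (0 < N_ex C zeta tau)%N.
  move=> tauC n /N_exP[Nle _]; rewrite lt0n; apply/eqP => N0.
  by move: Nle; rewrite N0 b0 leNgt tauC.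
(* The witnesses 0, 1 and [N_W] for the three cases ensure that the minimum defining [N_ex]
   exists. *)
have [n ntau] : exists n, fact_bound C zeta n <= tau.
  have [Ctau|tauC] := leP C tau; first by exists 0%N; rewrite b0.
  move: zeta0; rewrite le_eqVlt => /predU1P[/esym z0|z0].
    by exists 1%N; exact: zeta0_b1.
  by have [n _ ntau] := fact_bound_N_W tau0 tauC z0; exists n.
split=> [|Ctau|tauC z0|tauC z0].
- by apply: count; have [] := N_exP ntau.
- rewrite -b0 in Ctau; have [_] := N_exP Ctau.
  by rewrite leqn0 => /eqP.
- have b1 := zeta0_b1 z0; have [_ N1] := N_exP b1.
  by apply/eqP; rewrite eqn_leq N1 (N_ex_gt0 tauC _ b1).
- have [m -> mtau] := fact_bound_N_W tau0 tauC z0.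
  have [_ Nm] := N_exP mtau.
  by split; [rewrite lez_nat|exact: count].
Qed.
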